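(* 1. For every $n\ge 1$, every function $f:\{-1,1\}^n\to\{-1,1\}$ (balanced or not) and every randomized algorithm $A$ on $n$ input bits, $$\Pr[A(r,x)\neq f(x)]\ \ge\ \tfrac18\operatorname{Var}(f)-\tfrac14\,n\,\delta^2,$$ where the probability is over uniformly random $x\in\{-1,1\}^n$ and independent coins $r$, and $\delta=\delta(A)$. In particular, if an algorithm correctly computes a balanced Boolean function on most inputs most of the time, then $\delta\ge\Theta(n^{-1/2})$: there are absolute constants $\varepsilon_0>0$ and $c>0$ such that if $f:\{-1,1\}^n\to\{-1,1\}$ is balanced and $\Pr_r[A(r,x)=f(x)]\ge 1-\varepsilon_0$ for at least a fraction $1-\varepsilon_0$ of the inputs $x\in\{-1,1\}^n$, then $\delta(A)\ge c\,n^{-1/2}$. 2. For every $n\ge 1$, every monotone function $f:\{-1,1\}^n\to\{-1,1\}$ (balanced or not) and every randomized algorithm $A$ that correctly computes $f$ on all inputs all of the time, one has, with $\delta=\delta(A)$, $$\operatorname{Var}(f)\le \delta^{3/2}\,n^{1/2}.$$ In particular, there is an absolute constant $c>0$ such that if in addition $f$ is balanced, then $\delta(A)\ge c\,n^{-1/3}$.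
   Context: A function $f:\{-1,1\}^n\to\{-1,1\}$ is balanced if $\Pr[f(x)=1]=1/2$ for uniformly random $x\in\{-1,1\}^n$, and monotone if $f(x)\ge f(y)$ whenever $x_i\ge y_i$ for all $i=1,\dots,n$. $\operatorname{Var}(f)$ is the variance of $f(x)$ for uniformly random $x\in\{-1,1\}^n$. A randomized algorithm $A$ on $n$ input bits is a randomized adaptive query procedure (a probability distribution over deterministic decision trees): using random coins $r$ independent of the input, it reads input bits one at a time, each choice of the next bit to read (or the decision to stop and output a value in $\{-1,1\}$) depending only on the coins and on the values of the bits read so far. Write $A(r,x)$ for its output on input $x$ with coins $r$. It correctly computes $f$ on all inputs all of the time if $A(r,x)=f(x)$ for every $x$ and every (almost every) $r$. For a randomized algorithm $A$, let $\delta_i=\Pr[\text{bit } i \text{ gets read}]$, where the probability is over a uniformly random input $x\in\{-1,1\}^n$ and the independent coins of $A$, and let $\delta(A)=\max_{1\le i\le n}\delta_i$. *)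

(* Defs.v *)
From HB Require Import structures.
From mathcomp Require Import all_boot all_order all_algebra.
From mathcomp Require Import all_classical all_reals all_analysis.

Set Implicit Arguments.
Unset Strict Implicit.
Unset Printing Implicit Defensive.

Import Order.TTheory GRing.Theory Num.Theory.
Local Open Scope classical_set_scope.
Local Open Scope ring_scope.

(* The two-point set {-1, 1} is encoded by bool; order and variance are always
   taken through the embedding below. *)
Definition pm1 (b : bool) : int := if b then 1 else -1.

Definition cube (n : nat) := {ffun 'I_n -> bool}.

Definition monotone_bf (n : nat) (f : cube n -> bool) : Prop :=
  forall x y : cube n,
    (forall i, pm1 (y i) <= pm1 (x i)) -> pm1 (f y) <= pm1 (f x).

Section Uniform.
Context {R : realType} {n : nat}.

Definition unifE (g : cube n -> R) : R := (\sum_(x : cube n) g x) / 2 ^+ n.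

Definition unifPr (p : pred (cube n)) : R := #|p|%:R / 2 ^+ n.

Definition Var (f : cube n -> bool) : R :=
  let X x := (pm1 (f x))%:~R in unifE (fun x => (X x - unifE X) ^+ 2).

End Uniform.

Definition balanced (R : realType) (n : nat) (f : cube n -> bool) : Prop :=
  unifPr (fun x => pm1 (f x) == 1) = 2^-1 :> R.

(* [Query i t t'] reads bit i and continues with t if it is 1, with t' if it is
   -1.  A tree may query the same bit again; this gives no new information and
   does not affect the event that the bit gets read. *)
Inductive dtree (n : nat) : Type :=
| Output of bool
| Query of 'I_n & dtree n & dtree n.

Fixpoint eval (n : nat) (t : dtree n) (x : cube n) : bool :=
  match t with
  | Output b => b
  | Query i t1 t0 => if x i then eval t1 x else eval t0 x
  end.

Fixpoint reads (n : nat) (t : dtree n) (x : cube n) : seq 'I_n :=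
  match t with
  | Output _ => [::]
  | Query i t1 t0 => i :: (if x i then reads t1 x else reads t0 x)
  end.

(* A random decision tree on the coin space T; the countable set of trees
   carries the discrete sigma-algebra. *)
Record ralg (d : measure_display) (T : measurableType d) (n : nat) := RAlg {
  tree_of :> T -> dtree n ;
  measurable_tree_of : forall S : set (dtree n), measurable (tree_of @^-1` S)
}.

Section Algorithm.
Context {R : realType} {d : measure_display} {T : measurableType d}.
Context (P : probability T R) {n : nat}.

(* Probability of an event under the product of the uniform law of x on the
   cube and the law P of the coins r. *)
Definition jointPr (E : T -> cube n -> Prop) : R :=
  unifE (fun x => fine (P [set r | E r x])).

Definition err_prob (A : ralg T n) (f : cube n -> bool) : R :=
  jointPr (fun r x => eval (A r) x <> f x).

Definition delta_i (A : ralg T n) (i : 'I_n) : R :=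
  jointPr (fun r x => i \in reads (A r) x).

(* The default value 0 is harmless, the probabilities being nonnegative. *)
Definition delta (A : ralg T n) : R := \big[Num.max/0]_(i < n) delta_i A i.

Definition mostly_computes (eps : R) (A : ralg T n) (f : cube n -> bool) : Prop :=
  1 - eps <=
    unifPr (fun x => 1 - eps <= fine (P [set r | eval (A r) x = f x])).

(* For almost all coins, the output is right on all inputs. *)
Definition always_computes (A : ralg T n) (f : cube n -> bool) : Prop :=
  {ae P, forall r, forall x, eval (A r) x = f x}.

End Algorithm.

(* Main.v *)
Require Import Defs.
From mathcomp Require Import all_boot all_order all_algebra.
From mathcomp Require Import all_classical all_reals all_analysis.
From mathcomp Require Import ring lra.
Import Order.TTheory GRing.Theory Num.Theory.
Local Open Scope ring_scope.

(** The whole theorem rests on one inequality for a single decision tree t and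
    an arbitrary function g on the cube, the two-function form of the
    inequality of O'Donnell, Saks, Schramm and Servedio [osss_inequality]:
      |E(t g) - E t * E g| <= sum_i Pr(t reads i) * Inf_i(g),
    where Inf_i(g) is the probability that flipping bit i changes g.  It holds
    by induction on t.  If the root of t reads bit i, then E(t g) is the mean
    over b of E(t_b g_b), where t_b is the subtree for x_i = b and g_b is g with
    bit i forced to b.  Replacing g_b by g costs at most Inf_i(g), and this is
    the charge for reading bit i at the root; the induction hypothesis applies
    to t_b and the same g.  Not restricting g when descending is the point:
    this keeps the influences of the original g in the final bound.

    Lower bound on the error [var_le_error].  A tree cannot be influenced by a
    bit that it does not read, so Inf_i(t') <= Pr(t' reads i).  Hence two trees
    t, t' run on the same input are nearly as uncorrelated as on independent
    inputs, the defect being at most sum_i Pr(t reads i) * Pr(t' reads i).  When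
    they disagree, one of them errs.  Averaging over independent coins for t
    and t' gives 2 err >= (1 - m^2) / 2 - n delta^2 / 2, where m is the mean
    output.  As m is within 2 err of the mean of f, 1 - m^2 is at least
    Var f - 4 err.

    Monotone functions [var_le_delta].  With g = f = t the inequality reads
    Var f <= sum_i delta_i Inf_i(f) <= delta * I, I being the sum of the
    influences.  For monotone f, Inf_i(f) = E(f x_i), so that I = E(f S) with S
    the sum of the bits read, because an unread bit is uncorrelated with the
    output.  Each bit is a fair sign when it is read, so S is the endpoint of a
    stopped martingale and E(S^2) is the mean number of bits read.  By
    Cauchy-Schwarz I^2 <= sum_i delta_i <= n delta [sqr_sum_bit_corr_le].

    Random coins only enter through the law of the input-output-and-queries
    table of the tree, which has finitely many values [prob_beh]; an expectation
    over the coins is therefore a finite weighted average. *)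

Set Implicit Arguments.
Unset Strict Implicit.
Unset Printing Implicit Defensive.

(** * Finite weighted averages *)

Section WeightedAverage.
Context {R : realType}.

(** Averages over the inputs and over the coins are both of this form. *)
Definition wavg (I : finType) (w h : I -> R) : R := \sum_i w i * h i.

Variables (I : finType) (w : I -> R).
Implicit Types h k : I -> R.

Lemma eq_wavg h k : h =1 k -> wavg w h = wavg w k.
Proof. by move=> e; apply: eq_bigr => i _; rewrite e. Qed.

Lemma wavgD h k : wavg w (fun i => h i + k i) = wavg w h + wavg w k.
Proof. by rewrite -big_split; apply: eq_bigr => i _; rewrite mulrDr. Qed.

Lemma wavgZ c h : wavg w (fun i => c * h i) = c * wavg w h.
Proof. by rewrite /wavg mulr_sumr; apply: eq_bigr => i _; rewrite mulrCA. Qed.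

Lemma wavgZr c h : wavg w (fun i => h i * c) = wavg w h * c.
Proof. by rewrite mulrC -wavgZ; apply: eq_wavg => i; rewrite mulrC. Qed.

Lemma wavgN h : wavg w (fun i => - h i) = - wavg w h.
Proof. by rewrite -mulN1r -wavgZ; apply: eq_wavg => i; rewrite mulN1r. Qed.

Lemma wavgB h k : wavg w (fun i => h i - k i) = wavg w h - wavg w k.
Proof. by rewrite wavgD wavgN. Qed.

Lemma wavg_sum (J : finType) (h : J -> I -> R) :
  wavg w (fun i => \sum_j h j i) = \sum_j wavg w (h j).
Proof.
rewrite exchange_big; apply: eq_bigr => i _.
by rewrite mulr_sumr.
Qed.

Lemma exchange_wavg (J : finType) (v : J -> R) (h : I -> J -> R) :
  wavg w (fun i => wavg v (h i)) = wavg v (fun j => wavg w (h^~ j)).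
Proof.
rewrite [LHS]wavg_sum; apply: eq_bigr => j _.
exact: wavgZ.
Qed.

Hypothesis w_ge0 : forall i, 0 <= w i.

Lemma ler_wavg h k : (forall i, h i <= k i) -> wavg w h <= wavg w k.
Proof. by move=> hk; apply: ler_sum => i _; rewrite ler_wpM2l. Qed.

Lemma wavg_ge0 h : (forall i, 0 <= h i) -> 0 <= wavg w h.
Proof. by move=> h0; apply: sumr_ge0 => i _; rewrite mulr_ge0. Qed.

Lemma ler_norm_wavg h : `|wavg w h| <= wavg w (fun i => `|h i|).
Proof.
apply: le_trans (ler_norm_sum _ _ _) _.
by apply: ler_sum => i _; rewrite normrM ger0_norm.
Qed.

Hypothesis w_sum1 : \sum_i w i = 1.

Lemma wavg_cst c : wavg w (fun=> c) = c.
Proof. by rewrite /wavg -mulr_suml w_sum1 mul1r. Qed.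

End WeightedAverage.
Arguments eq_wavg {R I w h k} _.

(** * Mean, variance and influence on the cube *)

Section Cube.
Context {R : realType} {n : nat}.

Definition sgn (b : bool) : R := (pm1 b)%:~R.

Lemma sgnE b : sgn b = if b then 1 else -1.
Proof. by case: b. Qed.

Lemma sqr_sgn b : sgn b ^+ 2 = 1.
Proof. by case: b; rewrite sgnE ?sqrrN expr1n. Qed.

Definition unif (x : cube n) : R := (2 ^+ n)^-1.

Local Notation Ex := (wavg unif).

Lemma unif_ge0 x : 0 <= unif x.
Proof. by rewrite invr_ge0 exprn_ge0. Qed.

Lemma unif_sum1 : \sum_x unif x = 1.
Proof.
rewrite sumr_const card_ffun card_bool card_ord -[_ *+ _]mulr_natl natrX.
by rewrite divff // expf_neq0 // pnatr_eq0.
Qed.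

Lemma unifE_wavg (g : cube n -> R) : unifE g = Ex g.
Proof. by rewrite /unifE mulr_suml; apply: eq_bigr => x _; rewrite mulrC. Qed.

Lemma unifPr_wavg (p : pred (cube n)) : unifPr p = Ex (fun x => (p x)%:R).
Proof.
by rewrite -unifE_wavg /unifPr /unifE -sum1_card natr_sum big_mkcond /=; congr (_ / _);
  apply: eq_bigr => x _; rewrite unfold_in; case: (p x).
Qed.

Implicit Types (x : cube n) (g h : cube n -> bool).

Definition setbit (i : 'I_n) (b : bool) (x : cube n) : cube n :=
  [ffun j => if j == i then b else x j].

Definition flip (i : 'I_n) (x : cube n) : cube n := setbit i (~~ x i) x.

Lemma flipK i : involutive (flip i).
Proof.
move=> x; apply/ffunP => j; rewrite !ffunE eqxx negbK.
by case: eqP => [->|].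
Qed.

Lemma setbit_set i b c x : setbit i b (setbit i c x) = setbit i b x.
Proof. by apply/ffunP => j; rewrite !ffunE; case: eqP. Qed.

Lemma setbit_id i x : setbit i (x i) x = x.
Proof. by apply/ffunP => j; rewrite !ffunE; case: eqP => // ->. Qed.

Lemma flip_set i b x : flip i (setbit i b x) = setbit i (~~ b) x.
Proof. by rewrite /flip setbit_set ffunE eqxx. Qed.

Lemma Ex_flip i (g : cube n -> R) : Ex (fun x => g (flip i x)) = Ex g.
Proof. by rewrite [RHS](reindex_inj (inv_inj (flipK i))). Qed.

Lemma Ex_cond i (g : cube n -> R) :
  Ex g = (Ex (fun x => g (setbit i true x)) + Ex (fun x => g (setbit i false x))) / 2.
Proof.
have -> : Ex (fun x => g (setbit i true x)) + Ex (fun x => g (setbit i false x))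
          = Ex g + Ex (fun x => g (flip i x)).
  rewrite -!wavgD; apply: eq_wavg => x.
  rewrite -{3}(setbit_id i x) /flip.
  by case: (x i) => //=; rewrite addrC.
rewrite Ex_flip; lra.
Qed.

Definition mean (g : cube n -> bool) : R := Ex (fun x => sgn (g x)).

Lemma Var_mean (g : cube n -> bool) : Var g = 1 - mean g ^+ 2.
Proof.
rewrite /Var /= !unifE_wavg -/(mean g).
rewrite (eq_wavg (k := fun x => (1 + mean g ^+ 2) - (2 * mean g) * sgn (g x))); last first.
  by move=> x; have := sqr_sgn (g x); rewrite /sgn => h; ring: h.
rewrite wavgB wavgZ (wavg_cst unif_sum1) -/(mean g); ring.
Qed.

Lemma mean_itv g : -1 <= mean g <= 1.
Proof.
rewrite -ler_norml; apply: le_trans (ler_norm_wavg unif_ge0 _) _.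
rewrite (eq_wavg (k := fun=> 1)) ?(wavg_cst unif_sum1) // => x.
by case: (g x); rewrite sgnE ?normrN normr1.
Qed.

Definition covar (g h : cube n -> bool) : R :=
  Ex (fun x => sgn (g x) * sgn (h x)) - mean g * mean h.

Definition influence (i : 'I_n) (g : cube n -> bool) : R :=
  Ex (fun x => (g x != g (flip i x))%:R).

Lemma influence_ge0 i g : 0 <= influence i g.
Proof. by apply: (wavg_ge0 unif_ge0) => x; rewrite ler0n. Qed.

(** Forcing bit i changes g only at a pivotal input whose bit i is wrong; the
    probability is halved and the change doubled, so the constant is 1. *)
Lemma influence_setbit i b g :
  Ex (fun x => `|sgn (g (setbit i b x)) - sgn (g x)|) = influence i g.
Proof.
rewrite (Ex_cond i) /influence [RHS](Ex_cond i) -!wavgD.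
congr (_ / _); apply: eq_wavg => x.
rewrite !setbit_set !flip_set /=.
have e2 : `|2| = 2 :> R by rewrite ger0_norm ?ler0n.
by case: b; case: (g (setbit i true x)); case: (g (setbit i false x));
  rewrite !sgnE /= ?subrr ?normr0 ?opprK ?addr0 ?add0r -?opprD ?normrN ?e2.
Qed.

(** Pairing the two inputs that differ at bit i: monotonicity removes the
    absolute value from the difference of f along that edge. *)
Lemma influence_monotone i f :
  monotone_bf f -> influence i f = Ex (fun x => sgn (f x) * sgn (x i)).
Proof.
move=> fmon; rewrite /influence (Ex_cond i) [RHS](Ex_cond i) -!wavgD.
congr (_ / _); apply: eq_wavg => x.
rewrite !flip_set !ffunE eqxx /=.
have : pm1 (f (setbit i false x)) <= pm1 (f (setbit i true x)).
  by apply: fmon => j; rewrite !ffunE; case: eqP => // _; case: (x j).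
by case: (f (setbit i true x)); case: (f (setbit i false x)); rewrite !sgnE //= => _;
  rewrite ?mulr1 ?mul1r ?mulrNN ?mulr1 ?subrr ?addNr ?addr0.
Qed.

End Cube.

Local Notation Ex := (wavg unif).

(** * Decision trees and their subtrees *)

Section Tree.
Context {R : realType} {n : nat}.
Implicit Types (t : dtree n) (x y : cube n).

Lemma reads_agree t x y : {in reads t x, forall j, x j = y j} ->
  Defs.eval t y = Defs.eval t x /\ reads t y = reads t x.
Proof.
elim: t => [b|i t1 IH1 t0 IH0] //= h.
rewrite -(h i (mem_head _ _)).
have h' j : j \in (if x i then reads t1 x else reads t0 x) -> x j = y j.
  by move=> hj; apply: h; rewrite inE hj orbT.
by case: (x i) h' => h'; [case: (IH1 h') | case: (IH0 h')] => -> ->.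
Qed.

Lemma flip_unread t i x : i \notin reads t x ->
  Defs.eval t (flip i x) = Defs.eval t x /\ reads t (flip i x) = reads t x.
Proof.
move=> hi; apply: reads_agree => j hj; rewrite ffunE.
by case: eqP hj hi => // ->; move=> ->.
Qed.

(** Trees may query a bit again.  Substituting the value of the root bit in the
    subtrees makes the rest of the computation independent of that bit, which is
    what every induction below needs. *)
Fixpoint restrict (i : 'I_n) (b : bool) t : dtree n :=
  match t with
  | Output c => Output n c
  | Query j t1 t0 =>
      if j == i then (if b then restrict i b t1 else restrict i b t0)
      else Query j (restrict i b t1) (restrict i b t0)
  end.

Definition child i b t1 t0 : dtree n := restrict i b (if b then t1 else t0).

Lemma eval_restrict i b t x : Defs.eval (restrict i b t) x = Defs.eval t (setbit i b x).
Proof.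
elim: t => [c|j t1 IH1 t0 IH0] //=; rewrite ffunE.
by case: eqP => _ /=; [case: b IH1 IH0 | case: (x j)].
Qed.

Lemma mem_reads_restrict i b t x j :
  (j \in reads (restrict i b t) x) = (j != i) && (j \in reads t (setbit i b x)).
Proof.
elim: t => [c|k t1 IH1 t0 IH0] /=; first by rewrite andbF.
rewrite ffunE; have [->|ki] /= := eqVneq k i.
  rewrite inE; case: (eqVneq j i) IH1 IH0 => _; by case: b.
rewrite !inE; have [-> |jk] /= := eqVneq j k; first by rewrite ki.
by case: (x k).
Qed.

Lemma eval_child i b t1 t0 x :
  Defs.eval (Query i t1 t0) (setbit i b x) = Defs.eval (child i b t1 t0) x.
Proof. by rewrite eval_restrict /= ffunE eqxx; case: b. Qed.

Lemma mem_reads_child i b t1 t0 x j :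
  (j \in reads (Query i t1 t0) (setbit i b x)) =
  (j == i) || (j \in reads (child i b t1 t0) x).
Proof.
rewrite mem_reads_restrict /= ffunE eqxx inE.
by case: (j == i) => //=; case: b.
Qed.

Fixpoint depth t : nat :=
  match t with Output _ => 0%N | Query _ t1 t0 => (maxn (depth t1) (depth t0)).+1 end.

Lemma depth_restrict i b t : (depth (restrict i b t) <= depth t)%N.
Proof.
elim: t => [c|k t1 IH1 t0 IH0] //=; case: eqP => _ /=; last first.
  by rewrite ltnS geq_max !leq_max IH1 IH0 orbT.
by apply: leqW; case: b IH1 IH0 => IH1 IH0; rewrite leq_max ?IH1 ?IH0 ?orbT.
Qed.

(** Restricted subtrees are not structural subterms, but their depth is
    smaller. *)
Lemma dtree_child_ind (Q : dtree n -> Prop) :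
  (forall b, Q (Output n b)) ->
  (forall i t1 t0, (forall b, Q (child i b t1 t0)) -> Q (Query i t1 t0)) ->
  forall t, Q t.
Proof.
move=> Q0 QS t; have [k] := ubnP (depth t); elim: k t => // k IH [b|i t1 t0] //= lek.
rewrite ltnS in lek; apply: QS => b; apply: IH.
apply: (leq_ltn_trans (depth_restrict i b _)); apply: leq_trans lek; rewrite ltnS.
by case: b; rewrite ?leq_maxl ?leq_maxr.
Qed.

Definition readp t (i : 'I_n) : R := Ex (fun x => (i \in reads t x)%:R).

Lemma readp_ge0 t i : 0 <= readp t i.
Proof. by apply: (wavg_ge0 unif_ge0) => x; rewrite ler0n. Qed.

Lemma readp_child i t1 t0 j : readp (Query i t1 t0) j =
  (j == i)%:R + (readp (child i true t1 t0) j + readp (child i false t1 t0) j) / 2.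
Proof.
rewrite /readp (Ex_cond i).
have E b : Ex (fun x => (j \in reads (Query i t1 t0) (setbit i b x))%:R) =
   (j == i)%:R + Ex (fun x => (j \in reads (child i b t1 t0) x)%:R) :> R.
  rewrite -{1}(wavg_cst (@unif_sum1 R n) (j == i)%:R) -wavgD; apply: eq_wavg => x.
  rewrite mem_reads_child mem_reads_restrict.
  by case: (j == i) => /=; rewrite ?addr0 ?add0r.
rewrite !E; lra.
Qed.

Lemma mean_child i t1 t0 : mean (Defs.eval (Query i t1 t0)) =
  (mean (Defs.eval (child i true t1 t0)) + mean (Defs.eval (child i false t1 t0))) / 2 :> R.
Proof.
by rewrite /mean (Ex_cond i); congr ((_ + _) / _); apply: eq_wavg => x; rewrite eval_child.
Qed.

(** * The covariance inequality *)

(** By induction on the tree: each query pays for forcing the queried bit in g,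
    and g itself is never restricted. *)
Lemma osss_inequality t (g : cube n -> bool) :
  `|covar (Defs.eval t) g| <= \sum_i readp t i * influence i g :> R.
Proof.
elim/dtree_child_ind: t => [b|i t1 t0 IH].
  rewrite /covar /mean wavgZ (wavg_cst unif_sum1) subrr normr0.
  by apply: sumr_ge0 => i _; rewrite mulr_ge0 ?readp_ge0 ?influence_ge0.
pose s b (x : cube n) : R := sgn (Defs.eval (child i b t1 t0) x).
(* [D b] is the cost of forcing bit i to b in g. *)
pose D b : R := Ex (fun x => s b x * (sgn (g (setbit i b x)) - sgn (g x))).
have D_le b : `|D b| <= influence i g.
  rewrite -(influence_setbit i b g); apply: le_trans (ler_norm_wavg unif_ge0 _) _.
  apply: (ler_wavg unif_ge0) => x; rewrite normrM /s.
  by case: (Defs.eval _ _); rewrite sgnE ?normrN normr1 mul1r.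
have splitE : covar (Defs.eval (Query i t1 t0)) g =
    (D true + D false) / 2 +
    (covar (Defs.eval (child i true t1 t0)) g + covar (Defs.eval (child i false t1 t0)) g) / 2.
  rewrite /covar mean_child (Ex_cond i).
  have E b : Ex (fun x => sgn (Defs.eval (Query i t1 t0) (setbit i b x))
                          * sgn (g (setbit i b x))) = D b + Ex (fun x => s b x * sgn (g x)).
    by rewrite -wavgD; apply: eq_wavg => x; rewrite eval_child -mulrDr subrK.
  by rewrite !E /s; field.
have -> : \sum_j readp (Query i t1 t0) j * influence j g = influence i g +
   (\sum_j readp (child i true t1 t0) j * influence j g +
    \sum_j readp (child i false t1 t0) j * influence j g) / 2.
  have -> : influence i g = \sum_j (j == i)%:R * influence j g :> R.
    by rewrite (bigD1 i) //= eqxx mul1r big1 ?addr0 // => j /negPf ->; rewrite mul0r.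
  rewrite -big_split mulr_suml -big_split; apply: eq_bigr => j _ /=.
  by rewrite readp_child; field.
have := IH true; have := IH false; have := D_le true; have := D_le false.
rewrite splitE !ler_norml => /andP[? ?] /andP[? ?] /andP[? ?] /andP[? ?].
by apply/andP; split; lra.
Qed.

(** * Bits read by a tree *)

(** Turns the covariance inequality into a statement about queries only. *)
Lemma influence_le_readp t i : influence i (Defs.eval t) <= readp t i.
Proof.
apply: (ler_wavg unif_ge0) => x; rewrite ler_nat.
have [//|hi] := boolP (i \in reads t x); first by case: (_ != _).
by have [-> _] := flip_unread hi; rewrite eqxx.
Qed.

Definition readsum t x : R := \sum_i (i \in reads t x)%:R * sgn (x i).

Lemma readsum_child i b t1 t0 x :
  readsum (Query i t1 t0) (setbit i b x) = sgn b + readsum (child i b t1 t0) x.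
Proof.
have i_fresh : (i \in reads (child i b t1 t0) x) = false.
  by rewrite mem_reads_restrict eqxx.
have sumE t : \sum_j (j \in reads t x)%:R * sgn (x j) =
    (i \in reads t x)%:R * sgn (x i) +
    \sum_(j | j != i) (j \in reads t x)%:R * sgn (x j) :> R by rewrite (bigD1 i).
rewrite /readsum [RHS]addrC sumE i_fresh mul0r add0r addrC.
under eq_bigr do rewrite mem_reads_child.
rewrite (bigD1 i) //= eqxx mul1r ffunE eqxx; congr (_ + _).
by apply: eq_bigr => j /negPf ji; rewrite ffunE ji.
Qed.

(** The successive terms of the sum are fair signs given the past, so the cross
    terms of the square vanish. *)
Lemma Ex_readsum t : Ex (readsum t) = 0 /\ Ex (fun x => readsum t x ^+ 2) = \sum_i readp t i.
Proof.
elim/dtree_child_ind: t => [b|i t1 t0 IH].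
  have E x : readsum (Output n b) x = 0 by apply: big1 => i _; rewrite mul0r.
  have E0 : wavg (@unif R n) (fun=> 0) = 0 by rewrite (wavg_cst unif_sum1).
  split; first by rewrite (eq_wavg E).
  rewrite (eq_wavg (k := fun=> 0)) => [|x]; last by rewrite E expr0n.
  by rewrite E0 big1 // => i _; apply: E0.
have E1 b : Ex (fun x => readsum (Query i t1 t0) (setbit i b x)) = sgn b.
  rewrite -(wavg_cst (@unif_sum1 R n) (sgn b)) -[RHS]addr0 -(IH b).1 -wavgD.
  by apply: eq_wavg => x; rewrite readsum_child.
have E2 b : Ex (fun x => readsum (Query i t1 t0) (setbit i b x) ^+ 2) =
    1 + \sum_j readp (child i b t1 t0) j.
  rewrite -(IH b).2 -(wavg_cst (@unif_sum1 R n) 1) -[RHS]addr0.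
  rewrite -(mulr0 (2 * sgn b)) -(IH b).1 -wavgZ -!wavgD.
  apply: eq_wavg => x; rewrite readsum_child; have h := sqr_sgn (R:=R) b; ring: h.
rewrite (Ex_cond i) [X in _ /\ X = _](Ex_cond i) !E1 !E2 !sgnE; split; first lra.
under [RHS]eq_bigr do rewrite readp_child.
rewrite big_split -mulr_suml big_split /=.
have -> : \sum_j (j == i)%:R = 1 :> R.
  by rewrite (bigD1 i) //= eqxx big1 ?addr0 // => j /negPf ->.
by field.
Qed.

(** Flipping a bit that is not read reverses its sign and preserves the run. *)
Lemma Ex_unread_bit t i :
  Ex (fun x => sgn (Defs.eval t x) * sgn (x i)) =
  Ex (fun x => sgn (Defs.eval t x) * ((i \in reads t x)%:R * sgn (x i))) :> R.
Proof.
apply/eqP; rewrite -subr_eq0 -wavgB; apply/eqP.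
set h := (fun x => _); have : Ex (fun x => h (flip i x)) = - Ex h.
  rewrite -wavgN; apply: eq_wavg => x; rewrite /h.
  have [ix|hi] := boolP (i \in reads t x).
    have ix' : i \in reads t (flip i x).
      by move: ix; apply: contraLR => hi; have [_] := flip_unread hi; rewrite flipK => ->.
    by rewrite ix' !mul1r !subrr oppr0.
  have [-> ->] := flip_unread hi; rewrite (negPf hi) !mul0r !mulr0 !subr0.
  by rewrite ffunE eqxx; case: (x i); rewrite !sgnE ?mulr1 ?mulrN1 ?mulrN ?opprK.
by rewrite Ex_flip => ?; lra.
Qed.

(** The inequality of O'Donnell and Servedio on the degree-one coefficients of a
    decision tree. *)
Lemma sqr_sum_bit_corr_le t :
  (\sum_i Ex (fun x => sgn (Defs.eval t x) * sgn (x i))) ^+ 2 <= \sum_i readp t i :> R.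
Proof.
rewrite -(Ex_readsum t).2.
set a := \sum_i _.
have aE : a = Ex (fun x => sgn (Defs.eval t x) * readsum t x).
  rewrite /a; under eq_bigr do rewrite Ex_unread_bit.
  by rewrite -wavg_sum; apply: eq_wavg => x; rewrite mulr_sumr.
(* Cauchy-Schwarz, with a itself as the optimal multiplier. *)
have : 0 <= Ex (fun x => (a * sgn (Defs.eval t x) - readsum t x) ^+ 2).
  by apply: (wavg_ge0 unif_ge0) => x; rewrite sqr_ge0.
have -> : Ex (fun x => (a * sgn (Defs.eval t x) - readsum t x) ^+ 2) =
   a ^+ 2 - 2 * a * a + Ex (fun x => readsum t x ^+ 2).
  rewrite -{1}(wavg_cst (@unif_sum1 R n) (a ^+ 2)) {4}aE -wavgZ -wavgB -wavgD.
  by apply: eq_wavg => x; have h := sqr_sgn (R:=R) (Defs.eval t x); ring: h.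
by lra.
Qed.
End Tree.

(** * Random trees as finite mixtures *)

Section Mixture.
Context {R : realType} {d : measure_display} {T : measurableType d}.
Context (P : probability T R) {n : nat} (A : ralg T n).

(** All that probabilities of errors and of queries see of a tree.  Unlike the
    type of trees, this type is finite. *)
Definition behaviour : finType := {ffun cube n -> bool * {set 'I_n}}.

Definition beh (t : dtree n) : behaviour :=
  [ffun x => (Defs.eval t x, [set i in reads t x]%SET)].

Definition beh_law (b : behaviour) : R := fine (P (A @^-1` [set t | beh t = b])%classic).

(** The default tree is returned for tables that no tree realizes; these have
    weight 0. *)
Definition beh_tree (b : behaviour) : dtree n :=
  if pselect (exists t, beh t = b) is left ex then sval (cid ex) else Output n true.

Lemma beh_treeK t : beh (beh_tree (beh t)) = beh t.
Proof.
rewrite /beh_tree; case: pselect => [ex|[]]; last by exists t.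
by case: (cid ex).
Qed.

Lemma beh_law_ge0 b : 0 <= beh_law b.
Proof. by rewrite fine_ge0. Qed.

(** Finite additivity of P over the possible tables. *)
Lemma prob_beh (q : pred behaviour) :
  fine (P [set r | q (beh (A r))]%classic) = wavg beh_law (fun b => (q (beh (beh_tree b)))%:R).
Proof.
pose F b := (A @^-1` [set t | beh t = b])%classic.
have mF b : measurable (F b) by exact: measurable_tree_of.
have -> : [set r | q (beh (A r))]%classic = (\bigcup_(b in [set` q]) F b)%classic.
  apply/seteqP; split => [r /= qr|r [b /= qb] rb]; first by exists (beh (A r)).
  by rewrite rb.
rewrite measure_fin_bigcup //; last by move=> b c _ _ [r [<- <-]].
rewrite -(bigfs _ (index_enum_uniq behaviour)) => [|b _]; last by rewrite mem_index_enum.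
rewrite -sum_fine => [|b _]; last exact: fin_num_measure.
rewrite big_mkcond; apply: eq_bigr => b _.
have [[t <-]|no_t] := pselect (exists t, beh t = b).
  rewrite beh_treeK /beh_law -/(F _).
  by case: (q _); rewrite ?mulr1 ?mulr0.
have F0 : F b = set0 by apply/seteqP; split => // r rb; apply: no_t; exists (A r).
have -> : beh_law b = fine (P (F b)) by [].
by rewrite F0 !measure0 mul0r; case: (q b).
Qed.

Lemma beh_law_sum1 : \sum_b beh_law b = 1.
Proof.
have := prob_beh xpredT; have -> : [set r | true]%classic = [set: T]%classic by apply/seteqP.
by rewrite probability_setT /= /wavg => ->; apply: eq_bigr => b _; rewrite mulr1.
Qed.

Lemma jointPr_beh (q : cube n -> pred behaviour) :
  jointPr P (fun r x => q x (beh (A r))) =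
  wavg beh_law (fun b => Ex (fun x => (q x (beh (beh_tree b)))%:R)).
Proof.
rewrite exchange_wavg /jointPr unifE_wavg; apply: eq_wavg => x.
exact: prob_beh.
Qed.

Lemma err_prob_beh f : err_prob P A f =
  wavg beh_law (fun b => Ex (fun x => (Defs.eval (beh_tree b) x != f x)%:R)).
Proof.
have := jointPr_beh (fun x b => (b x).1 != f x).
have -> : jointPr P (fun r x => (beh (A r) x).1 != f x) = err_prob P A f.
  rewrite /err_prob /jointPr /unifE; congr (_ / _); apply: eq_bigr => x _.
  congr (fine (P _)); apply/seteqP.
  by split=> r /=; rewrite ffunE => /eqP.
move=> ->; apply: eq_wavg => b; apply: eq_wavg => x.
by rewrite ffunE.
Qed.

Lemma delta_i_beh i : delta_i P A i = wavg beh_law (fun b => readp (beh_tree b) i).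
Proof.
have := jointPr_beh (fun x b => i \in (b x).2).
have -> : jointPr P (fun r x => i \in (beh (A r) x).2) = delta_i P A i.
  rewrite /delta_i /jointPr /unifE; congr (_ / _); apply: eq_bigr => x _.
  by congr (fine (P _)); apply/seteqP; split=> r /=; rewrite ffunE inE.
move=> ->; apply: eq_wavg => b; apply: eq_wavg => x.
by rewrite ffunE inE.
Qed.

(** A table of positive weight cannot sit inside a null set of coins. *)
Lemma always_computes_beh f b :
  always_computes P A f -> beh_law b != 0 -> Defs.eval (beh_tree b) =1 f.
Proof.
move=> Af wb.
pose q (b : behaviour) := [exists x, (b x).1 != f x].
have : fine (P [set r | q (beh (A r))]%classic) = 0.
  rewrite measure_negligible //.
    by apply: (measurable_tree_of A [set t | q (beh t)]%classic).
  apply: negligibleS Af => r /= /existsP[x]; rewrite ffunE => /eqP ne E.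
  by apply: ne; exact: E.
rewrite prob_beh => /eqP; rewrite psumr_eq0; last first.
  by move=> c _; rewrite mulr_ge0 ?beh_law_ge0.
move/allP/(_ b (mem_index_enum b)); rewrite mulf_eq0 (negPf wb) /= pnatr_eq0 eqb0.
by move=> /existsPn nq x; have := nq x; rewrite ffunE negbK => /eqP.
Qed.

Lemma delta_ge0 : 0 <= delta P A.
Proof. exact: bigmax_ge_id. Qed.

Lemma le_delta i : delta_i P A i <= delta P A.
Proof. exact: le_bigmax. Qed.

Lemma delta_i_ge0 i : 0 <= delta_i P A i.
Proof.
rewrite delta_i_beh; apply: (wavg_ge0 beh_law_ge0) => b; exact: readp_ge0.
Qed.

(** * The two lower bounds *)

(** Two runs with independent coins on one input, compared with two runs on
    independent inputs. *)
Lemma var_le_error f :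
  8^-1 * Var f - 4^-1 * n%:R * delta P A ^+ 2 <= err_prob P A f.
Proof.
pose err b : R := Ex (fun x => (Defs.eval (beh_tree b) x != f x)%:R).
pose m b : R := mean (Defs.eval (beh_tree b)).
pose D b i : R := readp (beh_tree b) i.
have pair b c : 2^-1 - 2^-1 * (m b * m c) - 2^-1 * \sum_i D b i * D c i <= err b + err c.
  have disagree : 2^-1 - 2^-1 * Ex (fun x => sgn (Defs.eval (beh_tree b) x)
                   * sgn (Defs.eval (beh_tree c) x)) <= err b + err c.
    rewrite /err -wavgD -[X in X - _](wavg_cst (@unif_sum1 R n)) -wavgZ -wavgB.
    apply: (ler_wavg unif_ge0) => x.
    by case: (Defs.eval _ x); case: (Defs.eval _ x); case: (f x); rewrite !sgnE /=; lra.
  have := osss_inequality (R := R) (beh_tree b) (Defs.eval (beh_tree c)).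
  rewrite ler_norml /covar => /andP[_].
  have : \sum_i D b i * influence i (Defs.eval (beh_tree c)) <= \sum_i D b i * D c i.
    by apply: ler_sum => i _; rewrite ler_wpM2l ?readp_ge0 // influence_le_readp.
  rewrite -/(D b) -/(m b) -/(m c).
  by move=> h1 h2; move: disagree h1; rewrite /D in h2 *; lra.
pose e := err_prob P A f.
pose M := wavg beh_law m.
have cst := wavg_cst beh_law_sum1.
have dE i : wavg beh_law (fun b => D b i) = delta_i P A i by rewrite delta_i_beh.
have errE : wavg beh_law err = e by rewrite /e err_prob_beh.
(* The inequality is affine in each of the two trees: average over c, then b. *)
have avg1 b : 2^-1 - 2^-1 * (m b * M) - 2^-1 * \sum_i D b i * delta_i P A i <= err b + e.
  have := ler_wavg beh_law_ge0 (pair b).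
  rewrite !wavgB !wavgD !wavgZ (wavg_sum _ (fun i c => D b i * D c i)) !cst errE.
  by under eq_bigr do rewrite wavgZ dE.
have avg2 : 2^-1 - 2^-1 * M ^+ 2 - 2^-1 * \sum_i delta_i P A i ^+ 2 <= e + e.
  have := ler_wavg beh_law_ge0 avg1.
  rewrite !wavgB !wavgD !wavgZ (wavg_sum _ (fun i b => D b i * delta_i P A i)).
  rewrite !cst wavgZr errE.
  by under eq_bigr do rewrite wavgZr dE.
have sumd : \sum_i delta_i P A i ^+ 2 <= n%:R * delta P A ^+ 2.
  rewrite -[n in n%:R]card_ord -sum1_card natr_sum mulr_suml.
  by apply: ler_sum => i _; rewrite mul1r lerXn2r ?nnegrE ?delta_i_ge0 ?delta_ge0 ?le_delta.
have close : `|M - mean f| <= 2 * e.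
  rewrite -(cst (mean f)) -wavgB /e err_prob_beh -wavgZ.
  apply: le_trans (ler_norm_wavg beh_law_ge0 _) _.
  apply: (ler_wavg beh_law_ge0) => b; rewrite -wavgB -wavgZ.
  apply: le_trans (ler_norm_wavg unif_ge0 _) _.
  apply: (ler_wavg unif_ge0) => x.
  by case: (Defs.eval _ x); case: (f x); rewrite !sgnE /= ler_norml; apply/andP; split; lra.
have Mitv : -1 <= M <= 1.
  rewrite -ler_norml -(cst 1); apply: le_trans (ler_norm_wavg beh_law_ge0 _) _.
  by apply: (ler_wavg beh_law_ge0) => b; rewrite ler_norml mean_itv.
have nd0 : 0 <= n%:R * delta P A ^+ 2 by rewrite mulr_ge0 ?sqr_ge0 ?ler0n.
rewrite Var_mean -mulrA -/e; clear errE avg1.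
move: close Mitv (mean_itv (R := R) f) avg2 sumd nd0.
move: (mean f) M e (\sum_i _) (n%:R * _) => mu M0 e0 S N.
rewrite ler_norml => /andP[c1 c2] /andP[M1 M2] /andP[u1 u2] h hS N0.
have : M0 ^+ 2 - mu ^+ 2 <= 4 * e0 by nra.
lra.
Qed.

(** Squared, to postpone the fractional powers. *)
Lemma var_le_delta f : monotone_bf f -> always_computes P A f ->
  (Var f : R) ^+ 2 <= delta P A ^+ 3 * n%:R.
Proof.
move=> fmon Af.
pose I : R := \sum_i influence i f.
have I0 : 0 <= I by apply: sumr_ge0 => i _; apply: influence_ge0.
have cst := wavg_cst beh_law_sum1.
(* A bound valid for exact trees survives averaging: the others have weight 0. *)
have avg_le (h : behaviour -> R) c : (forall b, Defs.eval (beh_tree b) =1 f -> c <= h b) ->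
    c <= wavg beh_law h.
  move=> hc; rewrite -(cst c); apply: ler_sum => b _.
  have [->|wb] := eqVneq (beh_law b) 0; first by rewrite !mul0r.
  by rewrite ler_wpM2l ?beh_law_ge0 //; apply: hc; apply: always_computes_beh.
have varI : (Var f : R) <= delta P A * I.
  apply: (@le_trans _ _ (\sum_i delta_i P A i * influence i f)); last first.
    by rewrite mulr_sumr; apply: ler_sum => i _; rewrite ler_wpM2r ?influence_ge0 ?le_delta.
  under eq_bigr do rewrite delta_i_beh -wavgZr.
  rewrite -wavg_sum; apply: avg_le => b /funext fE.
  have := osss_inequality (R := R) (beh_tree b) f; rewrite fE; apply: le_trans.
  rewrite Var_mean; apply: le_trans (ler_norm _); rewrite /covar.
  rewrite (eq_wavg (k := fun=> 1)) ?(wavg_cst unif_sum1) ?expr2 // => x.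
  by rewrite -expr2 sqr_sgn.
have I2 : I ^+ 2 <= n%:R * delta P A.
  apply: (@le_trans _ _ (\sum_i delta_i P A i)); last first.
    rewrite -[n in n%:R]card_ord -sum1_card natr_sum mulr_suml.
    by apply: ler_sum => i _; rewrite mul1r le_delta.
  under eq_bigr do rewrite delta_i_beh.
  rewrite -wavg_sum; apply: avg_le => b /funext fE.
  have := sqr_sum_bit_corr_le (R := R) (beh_tree b); rewrite fE.
  by rewrite /I (eq_bigr _ (fun i _ => influence_monotone i fmon)).
have V0 : 0 <= (Var f : R).
  by rewrite Var_mean; have /andP[] := mean_itv (R := R) f; nra.
have d0 := delta_ge0.
apply: (@le_trans _ _ ((delta P A * I) ^+ 2)).
  by apply: lerXn2r => //; rewrite nnegrE //; apply: mulr_ge0.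
have -> : delta P A ^+ 3 * n%:R = delta P A ^+ 2 * (n%:R * delta P A) by ring.
by rewrite exprMn ler_wpM2l ?sqr_ge0.
Qed.

(** The error probability is at most eps on good inputs, and bad inputs have
    probability at most eps. *)
Lemma mostly_computes_err (eps : R) f : 0 <= eps -> mostly_computes P eps A f ->
  err_prob P A f <= 2 * eps.
Proof.
rewrite /mostly_computes unifPr_wavg => eps0 good.
have cst := wavg_cst (@unif_sum1 R n).
suff : err_prob P A f <= Ex (fun x => 1 + eps -
   (1 - eps <= fine (P [set r | Defs.eval (A r) x = f x]%classic))%R%:R).
  by rewrite wavgB cst; move: good; lra.
rewrite /err_prob /jointPr unifE_wavg; apply: (ler_wavg unif_ge0) => x.
have mE : measurable [set r | Defs.eval (A r) x = f x]%classic.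
  exact: (measurable_tree_of A [set t | Defs.eval t x = f x]%classic).
have -> : [set r | Defs.eval (A r) x <> f x]%classic =
   (~` [set r | Defs.eval (A r) x = f x])%classic by [].
rewrite probability_setC // fineB ?fin_num_measure //=.
have : 0 <= fine (P [set r | Defs.eval (A r) x = f x]%classic) by rewrite fine_ge0.
move: (fine _) => p p0.
by case: (lerP (1 - eps) p) => /=; lra.
Qed.
End Mixture.

Lemma Var_balanced (R : realType) n (f : cube n -> bool) : balanced R f -> Var f = 1 :> R.
Proof.
rewrite /balanced unifPr_wavg Var_mean => bal.
suff -> : mean f = 0 :> R by rewrite expr0n subr0.
have -> : mean f = Ex (fun x => 2 * (pm1 (f x) == 1)%:R - 1) :> R.
  by apply: eq_wavg => x; case: (f x); rewrite sgnE /=; lra.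
by rewrite wavgB wavgZ bal (wavg_cst unif_sum1); lra.
Qed.

Theorem theorem2 (R : realType) :
  (forall (n : nat) (f : cube n -> bool)
          (d : measure_display) (T : measurableType d) (P : probability T R)
          (A : ralg T n),
     (1 <= n)%N ->
     8^-1 * Var f - 4^-1 * n%:R * delta P A ^+ 2 <= err_prob P A f)
  /\
  (exists eps0 c : R, [/\ 0 < eps0, 0 < c &
     forall (n : nat) (f : cube n -> bool)
            (d : measure_display) (T : measurableType d) (P : probability T R)
            (A : ralg T n),
       (1 <= n)%N -> balanced R f -> mostly_computes P eps0 A f ->
       c * n%:R `^ (- 2^-1) <= delta P A])
  /\
  (forall (n : nat) (f : cube n -> bool)
          (d : measure_display) (T : measurableType d) (P : probability T R)
          (A : ralg T n),
     (1 <= n)%N -> monotone_bf f -> always_computes P A f ->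
     Var f <= delta P A `^ (3 / 2) * n%:R `^ 2^-1)
  /\
  (exists c : R, 0 < c /\
     forall (n : nat) (f : cube n -> bool)
            (d : measure_display) (T : measurableType d) (P : probability T R)
            (A : ralg T n),
       (1 <= n)%N -> monotone_bf f -> balanced R f -> always_computes P A f ->
       c * n%:R `^ (- 3^-1) <= delta P A).
Proof.
split; [|split; [|split]].
- by move=> n f d T P A _; apply: var_le_error.
(* For eps0 = 1/32 the error is at most 1/16, half of the main term 1/8, which leaves
   n delta^2 >= 1/4. *)
- exists 32^-1, 2^-1; split; [by lra | by lra | move=> n f d T P A n1 bal most].
  have e0 : 0 <= 32^-1 :> R by lra.
  have n0 : 0 < n%:R :> R by rewrite ltr0n.
  have := le_trans (var_le_error P A f) (mostly_computes_err e0 most).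
  rewrite (Var_balanced bal) => h.
  rewrite powRN powR12_sqrt ?ler0n // ler_pdivrMr ?sqrtr_gt0 //.
  rewrite -(@ler_pXn2r _ 2) ?nnegrE ?mulr_ge0 ?sqrtr_ge0 ?delta_ge0 //.
  rewrite exprMn sqr_sqrtr ?ler0n //; lra.
- move=> n f d T P A n1 fmon Af.
  have d0 := delta_ge0 P A.
  have := var_le_delta fmon Af => h.
  have -> : delta P A `^ (3 / 2) * n%:R `^ 2^-1 = Num.sqrt (delta P A ^+ 3 * n%:R).
    by rewrite powRrM powR_mulrn // -powRM ?exprn_ge0 // powR12_sqrt ?mulr_ge0 ?exprn_ge0.
  by rewrite (le_trans (ler_norm _)) // -sqrtr_sqr ler_wsqrtr.
- exists 1; split => // n f d T P A n1 fmon bal Af.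
  have d0 := delta_ge0 P A.
  have n0 : 0 < n%:R :> R by rewrite ltr0n.
  have := var_le_delta fmon Af; rewrite (Var_balanced bal) expr1n => h.
  rewrite mul1r powRN -(@ler_pXn2r _ 3) ?nnegrE ?invr_ge0 ?powR_ge0 //.
  rewrite exprVn -powR_mulrn ?powR_ge0 // -powRrM mulVf ?powRr1 ?pnatr_eq0 //.
  by rewrite -div1r ler_pdivrMr.
Qed.
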